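(* The Lebesgue number lemma strongly $N$-reduces to the following instance of the neighbourhood function principle: for every $Y^{2}$, with $A(\sigma)\equiv(\exists f^{1})(Y(f,\sigma)=0)$ for finite sequences $\sigma$ of natural numbers, there is $\gamma^{1}$ such that if $(\forall f^{1})(\exists n^{0})A(\overline{f}n)$ then $\gamma$ is a Kleene associate and $(\forall f^{1})A(\overline{f}\gamma(f))$.
   Context: Work in the language of higher-order arithmetic: type $0$ objects are natural numbers, type $1$ elements of $\mathbb{N}^{\mathbb{N}}$, type $2$ functionals $\mathbb{N}^{\mathbb{N}}\to\mathbb{N}$; finite sequences $\sigma$ of naturals are coded by naturals, $|\sigma|$ is the length, $\sigma*\tau$ concatenation, and $\overline{f}n=(f(0),\dots,f(n-1))$. Reals are represented by elements of $\mathbb{N}^{\mathbb{N}}$ in the standard way so that quantifiers over $[0,1]$ are quantifiers over $\mathbb{N}^{\mathbb{N}}$; functions $[0,1]\to\mathbb{R}$ are type-2 objects. A ''problem'' is a statement of the form $(\forall Y^{2})(\exists x^{1})A(Y,x)$. For problems $P_A\equiv(\forall Y^{2})(\exists x^{1})A(Y,x)$ and $P_B\equiv(\forall Z^{2})(\exists y^{1})B(Z,y)$, $P_B$ $N$-reduces to $P_A$ if there are $e\in\mathbb{N}$ and terms $s$, $t$ of Gödel's system $T$ with $(\forall Z^{2},x^{1})\big[A(t(Z),x)\to[\{e\}^{s(Z,x)}\downarrow\wedge B(Z,\{e\}^{s(Z,x)})]\big]$, where $\{e\}^{X}$ is the $e$-th Turing machine with oracle $X$; the reduction is strong if $s(Z,x)$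 can be taken as $u(x)$ for a term $u$ of Gödel's $T$ not depending on $Z$. A Kleene associate is $\alpha^{1}$ such that $(\forall\beta^{1})(\exists n)(\alpha(\overline{\beta}n)>0)$ and $(\forall\sigma,\tau)(\alpha(\sigma)>0\to\alpha(\sigma*\tau)=\alpha(\sigma))$; for such $\alpha$, $\alpha(f)$ denotes $\alpha(\overline{f}n)-1$ for the least $n$ with $\alpha(\overline{f}n)>0$. The Lebesgue number lemma is the problem: for every $\Psi:[0,1]\to\mathbb{R}^{+}$ there is $\delta>0$ such that every $Y\subseteq[0,1]$ with $\sup_{x,y\in Y}|x-y|<\delta$ is contained in some open ball $B(x,\Psi(x))$, $x\in[0,1]$. *)

(* Defs.v *)
From Stdlib Require Import Reals Arith List Lia Cantor.
From Coquelicot Require Import Coquelicot.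
Import ListNotations.

Open Scope nat_scope.

(** * Finite sequences and type-1 objects *)

Fixpoint seq_code (s : list nat) : nat :=
  match s with
  | [] => 0
  | a :: s' => S (Cantor.to_nat (a, seq_code s'))
  end.

Fixpoint seq_decode_fuel (fuel n : nat) : list nat :=
  match fuel, n with
  | S fuel', S m =>
      let (a, b) := Cantor.of_nat m in a :: seq_decode_fuel fuel' b
  | _, _ => []
  end.

Definition seq_decode (n : nat) : list nat := seq_decode_fuel n n.

Lemma seq_decode_fuelK (s : list nat) (fuel : nat) :
  seq_code s <= fuel -> seq_decode_fuel fuel (seq_code s) = s.
Proof.
  revert fuel; induction s as [|a s IH]; intros [|fuel] H;
    cbn [seq_code seq_decode_fuel] in *;
    try reflexivity; try lia.
  rewrite Cantor.cancel_of_to, IH; [reflexivity|].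
  pose proof (Cantor.to_nat_non_decreasing a (seq_code s)); lia.
Qed.

Lemma seq_codeK (s : list nat) : seq_decode (seq_code s) = s.
Proof. now apply seq_decode_fuelK. Qed.

Definition scons (n : nat) (f : nat -> nat) : nat -> nat :=
  fun k => match k with 0 => n | S k' => f k' end.

Definition initial (f : nat -> nat) (n : nat) : list nat :=
  List.map f (List.seq 0 n).

(** * Goedel's system T, interpreted in the full type structure over [nat] *)

Inductive ty : Type :=
| Nat : ty
| Arr : ty -> ty -> ty.

Definition ty1 : ty := Arr Nat Nat.
Definition ty2 : ty := Arr ty1 Nat.

Fixpoint ty_sem (a : ty) : Type :=
  match a with
  | Nat => nat
  | Arr a b => ty_sem a -> ty_sem b
  end.

Inductive var : list ty -> ty -> Type :=
| VZ : forall G a, var (a :: G) a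
| VS : forall G a b, var G a -> var (b :: G) a.

Inductive term : list ty -> ty -> Type :=
| Var : forall G a, var G a -> term G a
| Lam : forall G a b, term (a :: G) b -> term G (Arr a b)
| App : forall G a b, term G (Arr a b) -> term G a -> term G b
| Zero : forall G, term G Nat
| Succ : forall G, term G (Arr Nat Nat)
| Rec : forall G a,
    term G (Arr a (Arr (Arr Nat (Arr a a)) (Arr Nat a))).

Fixpoint env (G : list ty) : Type :=
  match G with
  | [] => unit
  | a :: G' => (ty_sem a * env G')%type
  end.

Fixpoint var_sem (G : list ty) (a : ty) (v : var G a) : env G -> ty_sem a :=
  match v in var G a return env G -> ty_sem a with
  | VZ G a => fun r => fst r
  | VS G a b v' => fun r => var_sem G a v' (snd r)
  end.

Fixpoint term_sem (G : list ty) (a : ty) (t : term G a) : env G -> ty_sem a :=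
  match t in term G a return env G -> ty_sem a with
  | Var G a v => var_sem G a v
  | Lam G a b t' => fun r x => term_sem (a :: G) b t' (x, r)
  | App G a b t1 t2 => fun r =>
      (term_sem G (Arr a b) t1 r) (term_sem G a t2 r)
  | Zero G => fun _ => 0
  | Succ G => fun _ => S
  | Rec G a => fun _ x f n => nat_rect (fun _ => ty_sem a) x f n
  end.

Definition closed_sem (a : ty) (t : term [] a) : ty_sem a :=
  term_sem [] a t tt.

(** * Oracle Turing machines

    A machine has a work tape and an oracle tape, both two-way infinite, with
    symbols in [nat] (0 is the blank) and states in [nat]; its program is a
    finite table, so only finitely many states and symbols matter.  The machine
    starts in state 0.  In state 1 it queries the oracle: the number [n] on the
    oracle tape is replaced by [X n], and the state becomes 2.  In every other
    state the first applicable instruction is executed, and the machine halts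
    when there is none.  Numbers are written in unary: the number on a tape is
    the length of the block of 1s that starts at the head and extends to the
    right. *)

Record tape : Type := Tape { left : list nat; head : nat; right : list nat }.

Definition move_left (t : tape) : tape :=
  match left t with
  | [] => Tape [] 0 (head t :: right t)
  | a :: l => Tape l a (head t :: right t)
  end.

Definition move_right (t : tape) : tape :=
  match right t with
  | [] => Tape (head t :: left t) 0 []
  | a :: r => Tape (head t :: left t) a r
  end.

Definition move (d : nat) (t : tape) : tape :=
  match d with
  | 0 => t
  | 1 => move_left t
  | _ => move_right t
  end.

Definition write (a : nat) (t : tape) : tape := Tape (left t) a (right t).

Definition write_number (n : nat) : tape :=
  match n with
  | 0 => Tape [] 0 []
  | S m => Tape [] 1 (repeat 1 m)
  end.

Fixpoint ones (l : list nat) : nat :=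
  match l with
  | 1 :: l' => S (ones l')
  | _ => 0
  end.

Definition read_number (t : tape) : nat := ones (head t :: right t).

Record instr : Type := Instr {
  in_state : nat; in_work : nat; in_oracle : nat;
  out_state : nat; out_work : nat; out_oracle : nat;
  dir_work : nat; dir_oracle : nat
}.

Record config : Type := Config {
  state : nat; work_tape : tape; oracle_tape : tape
}.

Definition applicable (c : config) (i : instr) : bool :=
  Nat.eqb (in_state i) (state c)
  && Nat.eqb (in_work i) (head (work_tape c))
  && Nat.eqb (in_oracle i) (head (oracle_tape c)).

Definition execute (i : instr) (c : config) : config :=
  Config (out_state i)
    (move (dir_work i) (write (out_work i) (work_tape c)))
    (move (dir_oracle i) (write (out_oracle i) (oracle_tape c))).

Definition step (M : list instr) (X : nat -> nat) (c : config)
  : option config :=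
  if Nat.eqb (state c) 1 then
    Some (Config 2 (work_tape c)
            (write_number (X (read_number (oracle_tape c)))))
  else
    match find (applicable c) M with
    | Some i => Some (execute i c)
    | None => None
    end.

Fixpoint run (M : list instr) (X : nat -> nat) (k : nat) (c : config)
  : config :=
  match k with
  | 0 => c
  | S k' => match step M X c with Some c' => run M X k' c' | None => c end
  end.

Definition start (n : nat) : config :=
  Config 0 (write_number n) (write_number 0).

(** An index [e] codes a finite sequence, read as a list of blocks of eight
    numbers, one for each instruction; an incomplete last block is dropped. *)
Fixpoint parse (l : list nat) : list instr :=
  match l with
  | q :: a :: b :: q' :: a' :: b' :: d :: d' :: l' =>
      Instr q a b q' a' b' d d' :: parse l'
  | _ => []
  end.

Definition machine (e : nat) : list instr := parse (seq_decode e).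

Lemma machine_surj (M : list instr) : exists e, machine e = M.
Proof.
  exists (seq_code (flat_map (fun i =>
    [in_state i; in_work i; in_oracle i; out_state i; out_work i;
     out_oracle i; dir_work i; dir_oracle i]) M)).
  unfold machine; rewrite seq_codeK.
  induction M as [|[] M IH]; simpl; [reflexivity|now rewrite IH].
Qed.

Definition computes (e : nat) (X : nat -> nat) (n m : nat) : Prop :=
  exists k,
    let c := run (machine e) X k (start n) in
    step (machine e) X c = None /\ read_number (work_tape c) = m.

(** * Problems and N-reduction *)

(** [P : problem] stands for the statement [forall Y, exists x, P Y x]. *)
Definition problem : Type := ((nat -> nat) -> nat) -> (nat -> nat) -> Prop.

(** Since machines are deterministic, [y] below is the unique total function
    computed by machine [e] with oracle [s Z x], when there is one. *)
Definition reduction (PB PA : problem) (e : nat)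
    (t : ((nat -> nat) -> nat) -> (nat -> nat) -> nat)
    (s : ((nat -> nat) -> nat) -> (nat -> nat) -> nat -> nat) : Prop :=
  forall (Z : (nat -> nat) -> nat) (x : nat -> nat),
    PA (t Z) x ->
    exists y : nat -> nat, (forall n, computes e (s Z x) n (y n)) /\ PB Z y.

Definition N_reduces (PB PA : problem) : Prop :=
  exists (e : nat) (t : term [] (Arr ty2 ty2))
    (s : term [] (Arr ty2 (Arr ty1 ty1))),
    reduction PB PA e (closed_sem _ t) (closed_sem _ s).

Definition strongly_N_reduces (PB PA : problem) : Prop :=
  exists (e : nat) (t : term [] (Arr ty2 ty2)) (u : term [] (Arr ty1 ty1)),
    reduction PB PA e (closed_sem _ t) (fun _ x => closed_sem _ u x).

(** * The neighbourhood function principle *)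

Definition kleene_associate (alpha : nat -> nat) : Prop :=
  (forall beta : nat -> nat, exists n, alpha (seq_code (initial beta n)) > 0)
  /\ (forall sigma tau : list nat,
        alpha (seq_code sigma) > 0 ->
        alpha (seq_code (sigma ++ tau)) = alpha (seq_code sigma)).

Definition associate_value (alpha f : nat -> nat) (v : nat) : Prop :=
  exists n,
    alpha (seq_code (initial f n)) > 0
    /\ (forall m, m < n -> alpha (seq_code (initial f m)) = 0)
    /\ v = alpha (seq_code (initial f n)) - 1.

(** The type-2 object [Y] takes the pair [(f, sigma)] as the single type-1
    argument obtained by putting the code of [sigma] in front of [f]. *)
Definition NFP_formula (Y : (nat -> nat) -> nat) (sigma : list nat) : Prop :=
  exists f : nat -> nat, Y (scons (seq_code sigma) f) = 0.

Definition NFP : problem := fun Y gamma =>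
  (forall f : nat -> nat, exists n, NFP_formula Y (initial f n)) ->
  kleene_associate gamma
  /\ (forall f : nat -> nat, exists v,
        associate_value gamma f v /\ NFP_formula Y (initial f v)).

(** * The Lebesgue number lemma *)

Open Scope R_scope.

Definition rat_of_code (n : nat) : R :=
  let (p, c) := Cantor.of_nat n in
  let (a, b) := Cantor.of_nat p in
  (INR a - INR b) / INR (S c).

(** Reals are represented by fast converging Cauchy sequences of codes of
    rationals. *)
Definition represents (f : nat -> nat) (x : R) : Prop :=
  (forall k i : nat,
     Rabs (rat_of_code (f k) - rat_of_code (f (k + i)%nat)) <= / 2 ^ k)
  /\ is_lim_seq (fun k => rat_of_code (f k)) x.

(** The type-2 object [Z] codes the map sending [f] to the sequence
    [n |-> Z (scons n f)]; this map has to send every representative of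
    [x] in [0,1] to a representative of [Psi x].  The values of [Psi] outside
    [0,1] are irrelevant. *)
Definition represents_pos_fun (Z : (nat -> nat) -> nat) (Psi : R -> R) : Prop :=
  forall x : R, 0 <= x <= 1 ->
    0 < Psi x
    /\ (forall f : nat -> nat,
          represents f x -> represents (fun n => Z (scons n f)) (Psi x)).

(** [Lub_Rbar] of the empty set is [m_infty], so the empty [Y] is covered. *)
Definition diameter (Y : R -> Prop) : Rbar :=
  Lub_Rbar (fun d => exists x y : R, Y x /\ Y y /\ d = Rabs (x - y)).

Definition lebesgue_number (Psi : R -> R) (delta : R) : Prop :=
  0 < delta
  /\ (forall Y : R -> Prop,
        (forall y, Y y -> 0 <= y <= 1) ->
        Rbar_lt (diameter Y) delta ->
        exists x, 0 <= x <= 1 /\ (forall y, Y y -> Rabs (y - x) < Psi x)).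

Definition lebesgue_number_lemma : problem := fun Z d =>
  forall Psi : R -> R,
    represents_pos_fun Z Psi ->
    exists delta : R, represents d delta /\ lebesgue_number Psi delta.

(* Main.v *)
From Stdlib Require Import Reals Arith List Lia Lra Cantor.
From Stdlib Require Import FunctionalExtensionality ClassicalEpsilon.
From Coquelicot Require Import Coquelicot.
Require Import Defs.
Import ListNotations.

(** Ask of a finite sequence [s] that some real [x] whose binary expansion extends
    [s] satisfies [Psi x > 2 * 2^-|s|]; then [B(x, Psi x)] contains the
    [2^-|s|]-neighbourhood of the dyadic interval of [s].  Positivity of [Psi] makes
    every branch reach such an [s], and membership has a decidable witness: the
    digits of [x] and an approximation of [Psi x].  A neighbourhood function [gamma]
    for this predicate is bounded on Cantor space, and [2^-M] is a Lebesgue number as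
    soon as [gamma] takes values in [1, M + 1] on all binary sequences of length [M].

    Searching for the least such [M] need not terminate when the premise of the
    principle fails.  But [k |-> 2^-min(k, M)] is a fast Cauchy sequence with limit
    [2^-M] that is primitive recursive in [gamma], so a term of system T produces the
    answer and the machine only has to query its oracle. *)

Open Scope nat_scope.

(** * Primitive recursive operations in system T *)

Arguments VZ {G a}.
Arguments VS {G a b} _.
Arguments Var {G a} _.
Arguments Lam {G a b} _.
Arguments App {G a b} _ _.
Arguments Zero {G}.
Arguments Succ {G}.
Arguments Rec {G} a.
Arguments term_sem {G a} _ _.
Arguments var_sem {G a} _ _.

Local Notation "f @@ x" := (App f x) (at level 41, left associativity).
Local Notation v0 := (Var VZ).
Local Notation v1 := (Var (VS VZ)).
Local Notation v2 := (Var (VS (VS VZ))).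
Local Notation v3 := (Var (VS (VS (VS VZ)))).
Local Notation v4 := (Var (VS (VS (VS (VS VZ))))).

Definition pred_term {G} : term G (Arr Nat Nat) :=
  Lam (Rec Nat @@ Zero @@ Lam (Lam v1) @@ v0).

Definition add_term {G} : term G (Arr Nat (Arr Nat Nat)) :=
  Lam (Lam (Rec Nat @@ v1 @@ Lam Succ @@ v0)).

Definition mul_term {G} : term G (Arr Nat (Arr Nat Nat)) :=
  Lam (Lam (Rec Nat @@ Zero @@ Lam (Lam (add_term @@ v0 @@ v3)) @@ v0)).

Definition sub_term {G} : term G (Arr Nat (Arr Nat Nat)) :=
  Lam (Lam (Rec Nat @@ v1 @@ Lam pred_term @@ v0)).

(** Vanishes exactly when both numbers agree, so that a conjunction of equations becomes the
    vanishing of a sum. *)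
Definition dist (x y : nat) : nat := (x - y) + (y - x).

Definition dist_term {G} : term G (Arr Nat (Arr Nat Nat)) :=
  Lam (Lam (add_term @@ (sub_term @@ v1 @@ v0) @@ (sub_term @@ v0 @@ v1))).

Definition pair_code (x y : nat) : nat := Cantor.to_nat (x, y).

(** The inner recursion is the triangular number of [y + x], shaped as in [Cantor.to_nat] so that
    the two agree by conversion. *)
Definition pair_term {G} : term G (Arr Nat (Arr Nat Nat)) :=
  Lam (Lam (add_term @@ v0 @@
    (Rec Nat @@ Zero @@ Lam (Lam (add_term @@ (Succ @@ v1) @@ v0))
       @@ (add_term @@ v0 @@ v1)))).

Definition rat_code (a b c : nat) : nat := pair_code (pair_code a b) c.

Definition rat_term {G} : term G (Arr Nat (Arr Nat (Arr Nat Nat))) :=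
  Lam (Lam (Lam (pair_term @@ (pair_term @@ v2 @@ v1) @@ v0))).

Definition cons_code (a c : nat) : nat := S (pair_code a c).

Definition cons_term {G} : term G (Arr Nat (Arr Nat Nat)) :=
  Lam (Lam (Succ @@ (pair_term @@ v1 @@ v0))).

(* The accumulator [c] avoids traversing the sequence from its end. *)
Definition prefix_code (g : nat -> nat) (n : nat) : nat :=
  nat_rect (fun _ => nat -> nat) (fun c => c)
    (fun k E c => E (cons_code (g k) c)) n 0.

Definition prefix_term {G} : term G (Arr ty1 (Arr Nat Nat)) :=
  Lam (Lam (Rec ty1 @@ Lam v0
    @@ Lam (Lam (Lam (v1 @@ (cons_term @@ (v4 @@ v2) @@ v0)))) @@ v0 @@ Zero)).

Definition scons_term {G} : term G (Arr Nat (Arr ty1 ty1)) :=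
  Lam (Lam (Lam (Rec Nat @@ v2 @@ Lam (Lam (v3 @@ v1)) @@ v0))).

(** This is [2^k - 1]: codes of rationals store the denominator minus one. *)
Definition pow2_pred (k : nat) : nat :=
  nat_rect (fun _ => nat) 0 (fun _ r => S (r + r)) k.

Definition pow2_pred_term {G} : term G (Arr Nat Nat) :=
  Lam (Rec Nat @@ Zero @@ Lam (Lam (Succ @@ (add_term @@ v0 @@ v0))) @@ v0).

(** Truncating entries to 0 or 1 lets every element of Baire space serve as a binary expansion. *)
Definition bit (n : nat) : nat := nat_rect (fun _ => nat) 0 (fun _ _ => 1) n.

Definition bit_term {G} : term G (Arr Nat Nat) :=
  Lam (Rec Nat @@ Zero @@ Lam (Lam (Succ @@ Zero)) @@ v0).

Definition numer (g : nat -> nat) (k : nat) : nat :=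
  nat_rect (fun _ => nat) 0 (fun i r => r + r + bit (g i)) k.

Definition numer_term {G} : term G (Arr ty1 (Arr Nat Nat)) :=
  Lam (Lam (Rec Nat @@ Zero
    @@ Lam (Lam (add_term @@ (add_term @@ v0 @@ v0) @@ (bit_term @@ (v3 @@ v1))))
    @@ v0)).

Definition binary_real (g : nat -> nat) (k : nat) : nat :=
  rat_code (numer g k) 0 (pow2_pred k).

Definition binary_real_term {G} : term G (Arr ty1 ty1) :=
  Lam (Lam (rat_term @@ (numer_term @@ v1 @@ v0) @@ Zero @@ (pow2_pred_term @@ v0))).

Fixpoint const_term {G} (n : nat) : term G Nat :=
  match n with 0 => Zero | S m => Succ @@ const_term m end.

(** * Semantics of the terms *)

Lemma pred_term_sem G : term_sem (@pred_term G) = fun _ => Nat.pred.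
Proof. now extensionality r; extensionality n; destruct n. Qed.

Lemma add_term_sem G : term_sem (@add_term G) = fun _ => Nat.add.
Proof.
  extensionality r; extensionality x; extensionality y; cbn.
  induction y as [|y IH]; cbn; [|rewrite IH]; lia.
Qed.

Lemma mul_term_sem G : term_sem (@mul_term G) = fun _ => Nat.mul.
Proof.
  extensionality r; extensionality x; extensionality y.
  unfold mul_term; cbn [term_sem]; rewrite add_term_sem; cbn.
  induction y as [|y IH]; cbn; [|rewrite IH]; lia.
Qed.

Lemma sub_term_sem G : term_sem (@sub_term G) = fun _ => Nat.sub.
Proof.
  extensionality r; extensionality x; extensionality y.
  unfold sub_term; cbn [term_sem]; rewrite pred_term_sem; cbn.
  induction y as [|y IH]; cbn; [|rewrite IH]; lia.
Qed.

Lemma dist_term_sem G : term_sem (@dist_term G) = fun _ => dist.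
Proof.
  unfold dist_term; cbn [term_sem]; now rewrite add_term_sem, sub_term_sem.
Qed.

Lemma pair_term_sem G : term_sem (@pair_term G) = fun _ => pair_code.
Proof.
  unfold pair_term; cbn [term_sem]; now rewrite !add_term_sem.
Qed.

Lemma rat_term_sem G : term_sem (@rat_term G) = fun _ => rat_code.
Proof. unfold rat_term; cbn [term_sem]; now rewrite pair_term_sem. Qed.

Lemma cons_term_sem G : term_sem (@cons_term G) = fun _ => cons_code.
Proof. unfold cons_term; cbn [term_sem]; now rewrite pair_term_sem. Qed.

Lemma prefix_term_sem G : term_sem (@prefix_term G) = fun _ => prefix_code.
Proof. unfold prefix_term; cbn [term_sem]; now rewrite cons_term_sem. Qed.

Lemma scons_term_sem G : term_sem (@scons_term G) = fun _ => scons.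
Proof.
  extensionality r; extensionality n; extensionality f; extensionality k.
  now destruct k.
Qed.

Lemma pow2_pred_term_sem G : term_sem (@pow2_pred_term G) = fun _ => pow2_pred.
Proof. unfold pow2_pred_term; cbn [term_sem]; now rewrite add_term_sem. Qed.

Lemma bit_term_sem G : term_sem (@bit_term G) = fun _ => bit.
Proof. reflexivity. Qed.

Lemma numer_term_sem G : term_sem (@numer_term G) = fun _ => numer.
Proof.
  unfold numer_term; cbn [term_sem]; now rewrite add_term_sem, bit_term_sem.
Qed.

Lemma binary_real_term_sem G :
  term_sem (@binary_real_term G) = fun _ => binary_real.
Proof.
  unfold binary_real_term; cbn [term_sem].
  now rewrite rat_term_sem, numer_term_sem, pow2_pred_term_sem.
Qed.

Lemma const_term_sem G n : term_sem (@const_term G n) = fun _ => n.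
Proof. induction n as [|n IH]; cbn; [|rewrite IH]; reflexivity. Qed.

Lemma app_term_sem G a b (f : term G (Arr a b)) (x : term G a) :
  term_sem (f @@ x) = fun r => term_sem f r (term_sem x r).
Proof. reflexivity. Qed.

Lemma lam_term_sem G a b (t : term (a :: G) b) :
  term_sem (Lam t) = fun r x => term_sem t (x, r).
Proof. reflexivity. Qed.

Lemma lam1_term_sem G (t : term (Nat :: G) Nat) :
  @term_sem G ty1 (Lam t) = fun r x => term_sem t (x, r).
Proof. reflexivity. Qed.

(* Rewriting with the semantics of the arithmetical terms, rather than reducing, is
   essential: unfolding them during conversion is exponential. *)
Ltac term_simpl :=
  rewrite ?lam_term_sem, ?lam1_term_sem, ?app_term_sem, ?add_term_sem, ?mul_term_sem,
    ?sub_term_sem, ?dist_term_sem, ?rat_term_sem, ?cons_term_sem,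
    ?prefix_term_sem, ?scons_term_sem, ?pow2_pred_term_sem,
    ?binary_real_term_sem, ?const_term_sem.

(** * The instance of the neighbourhood function principle *)

(* With [P = 2^n], the last summand vanishes iff [(a - b) / (c + 1) > 3 / 2^n]. *)
Definition cover_test (Z : (nat -> nat) -> nat)
    (sigma n a b c : nat) (g : nat -> nat) : nat :=
  let P := S (pow2_pred n) in
  dist (prefix_code g n) sigma
  + dist (rat_code a b c) (Z (scons n (binary_real g)))
  + (S (b * P + 3 * S c) - a * P).

(** The witness carries [a], [b], [c] besides the digits, so the test only has to encode a rational
    and compare, never to decode one. *)
Definition cover_functional (Z : (nat -> nat) -> nat) (h : nat -> nat) : nat :=
  cover_test Z (h 0) (h 1) (h 2) (h 3) (h 4) (fun k => h (5 + k)).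

Definition cover_term : term [] (Arr ty2 ty2) :=
  let h {G} k : term (ty1 :: ty2 :: G) Nat := v0 @@ const_term k in
  let g {G} : term (ty1 :: ty2 :: G) ty1 :=
    Lam (v1 @@ (add_term @@ const_term 5 @@ v0)) in
  let P {G} : term (ty1 :: ty2 :: G) Nat := Succ @@ (pow2_pred_term @@ h 1) in
  Lam (Lam (add_term
    @@ (add_term
        @@ (dist_term @@ (prefix_term @@ g @@ h 1) @@ h 0)
        @@ (dist_term @@ (rat_term @@ h 2 @@ h 3 @@ h 4)
            @@ (v1 @@ (scons_term @@ h 1 @@ (binary_real_term @@ g)))))
    @@ (sub_term
        @@ (Succ @@ (add_term @@ (mul_term @@ h 3 @@ P)
                     @@ (mul_term @@ const_term 3 @@ (Succ @@ h 4))))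
        @@ (mul_term @@ h 2 @@ P)))).

Lemma cover_term_sem : closed_sem _ cover_term = cover_functional.
Proof. unfold closed_sem, cover_term; cbv zeta; repeat term_simpl; reflexivity. Qed.

(** * Extracting a modulus from a neighbourhood function *)

(** By truncated subtraction, zero exactly when [1 <= gamma c <= S e]. *)
Definition bad_leaf (gamma : nat -> nat) (e c : nat) : nat :=
  (1 - gamma c) + (gamma c - S e).

(* [bad_sum gamma e j (seq_code s)] sums [bad_leaf] over all [tau ++ s] with [tau]
   binary of length [j]. *)
Definition bad_sum (gamma : nat -> nat) (e j c : nat) : nat :=
  nat_rect (fun _ => nat -> nat) (bad_leaf gamma e)
    (fun _ F c => F (cons_code 0 c) + F (cons_code 1 c)) j c.

(* [depth gamma k] is the minimum of [k] and the first [e] such that [gamma] takes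
   values in [1, e + 1] on all binary sequences of length [e]. *)
Definition depth (gamma : nat -> nat) (k : nat) : nat :=
  nat_rect (fun _ => nat) 0
    (fun _ e => nat_rect (fun _ => nat) e (fun _ _ => S e)
                  (bad_sum gamma e e 0)) k.

Definition radius (gamma : nat -> nat) (k : nat) : nat :=
  rat_code 1 0 (pow2_pred (depth gamma k)).

Definition bad_sum_term {G} : term G (Arr ty1 (Arr Nat (Arr Nat ty1))) :=
  Lam (Lam (Lam (Lam (Rec ty1
    @@ Lam (add_term @@ (sub_term @@ const_term 1 @@ (v4 @@ v0))
                     @@ (sub_term @@ (v4 @@ v0) @@ (Succ @@ v3)))
    @@ Lam (Lam (Lam (add_term @@ (v1 @@ (cons_term @@ const_term 0 @@ v0))
                               @@ (v1 @@ (cons_term @@ const_term 1 @@ v0)))))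
    @@ v1 @@ v0)))).

Lemma bad_sum_term_sem G : term_sem (@bad_sum_term G) = fun _ => bad_sum.
Proof. unfold bad_sum_term; repeat term_simpl; reflexivity. Qed.

Definition radius_term : term [] (Arr ty1 ty1) :=
  Lam (Lam (rat_term @@ const_term 1 @@ const_term 0 @@ (pow2_pred_term @@
    (Rec Nat @@ Zero
     @@ Lam (Lam (Rec Nat @@ v0 @@ Lam (Lam (Succ @@ v2))
                  @@ (bad_sum_term @@ v3 @@ v0 @@ v0 @@ Zero)))
     @@ v0)))).

Lemma radius_term_sem : closed_sem _ radius_term = radius.
Proof.
  unfold closed_sem, radius_term; repeat term_simpl; rewrite bad_sum_term_sem; reflexivity.
Qed.

(** * A machine that returns the oracle's answer *)

(** State 0 moves the input to the oracle tape, filling it leftwards; one step right puts the oracle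
    head on the block before the query. State 2 moves the answer back in the same way, and state 3
    halts. *)
Definition query_machine : list instr :=
  [ Instr 0 1 0 0 0 1 2 1;
    Instr 0 0 0 1 0 0 0 2;
    Instr 2 0 1 2 1 0 1 2;
    Instr 2 0 0 3 0 0 2 0 ].

Definition reaches (M : list instr) (X : nat -> nat) (c c' : config) : Prop :=
  exists k, run M X k c = c'.

Lemma run_halted M X k c : step M X c = None -> run M X k c = c.
Proof. intros H; destruct k; cbn; [|rewrite H]; reflexivity. Qed.

Lemma run_add M X j k c : run M X (j + k) c = run M X k (run M X j c).
Proof.
  revert c; induction j as [|j IH]; intros c; cbn; [reflexivity|].
  destruct (step M X c) eqn:E; [apply IH|now rewrite run_halted].
Qed.

Lemma reaches_trans M X c1 c2 c3 :
  reaches M X c1 c2 -> reaches M X c2 c3 -> reaches M X c1 c3.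
Proof.
  intros [j Hj] [k Hk]; exists (j + k); rewrite run_add; now subst.
Qed.

Lemma reaches_step M X c c' c'' :
  step M X c = Some c' -> reaches M X c' c'' -> reaches M X c c''.
Proof. intros H [k Hk]; exists (S k); cbn; now rewrite H. Qed.

Lemma ones_repeat n : ones (repeat 1 n) = n.
Proof. induction n; cbn; congruence. Qed.

Definition number_tape (l : list nat) (n : nat) : tape :=
  match n with 0 => Tape l 0 [] | S m => Tape l 1 (repeat 1 m) end.

Lemma write_number_tape n : write_number n = number_tape [] n.
Proof. now destruct n. Qed.

Lemma query_machine_copy_in X n p m :
  reaches query_machine X
    (Config 0 (number_tape (repeat 0 p) n) (Tape [] 0 (repeat 1 m)))
    (Config 0 (Tape (repeat 0 (n + p)) 0 []) (Tape [] 0 (repeat 1 (n + m)))).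
Proof.
  revert p m; induction n as [|n IH]; intros p m; [now exists 0|].
  eapply reaches_step; [reflexivity|].
  replace (S n + p) with (n + S p) by lia; replace (S n + m) with (n + S m) by lia.
  eapply reaches_trans; [|apply IH]; exists 0.
  now destruct n.
Qed.

Lemma query_machine_copy_out X v p l m :
  exists p' l',
  reaches query_machine X
    (Config 2 (Tape (repeat 0 p) 0 (repeat 1 m)) (number_tape l v))
    (Config 2 (Tape (repeat 0 p') 0 (repeat 1 (v + m))) (Tape l' 0 [])).
Proof.
  revert p l m; induction v as [|v IH]; intros p l m;
    [now exists p, l; exists 0|].
  (* A left move uses up one stored blank; with [p = 0] the tape supplies a fresh one, in accordance
     with [p - 1 = 0]. *)
  destruct (IH (p - 1) (0 :: l) (S m)) as (p' & l' & H); exists p', l'.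
  eapply reaches_step; [reflexivity|].
  replace (S v + m) with (v + S m) by lia.
  eapply reaches_trans; [|apply H]; exists 0.
  destruct p, v; cbn; rewrite ?Nat.sub_0_r; reflexivity.
Qed.

Lemma query_machine_reaches X n :
  exists l a r o,
  reaches query_machine X (start n) (Config 3 (Tape l a r) o)
  /\ ones (a :: r) = X n.
Proof.
  destruct (query_machine_copy_out X (X n) n [] 0) as (p' & l' & H).
  exists (0 :: repeat 0 p'), (List.hd 0 (repeat 1 (X n))),
    (repeat 1 (X n - 1)), (Tape l' 0 []).
  split.
  - unfold start; rewrite write_number_tape.
    eapply reaches_trans; [apply (query_machine_copy_in X n 0 0)|].
    eapply reaches_step; [reflexivity|].
    eapply reaches_step; [reflexivity|].
    rewrite !Nat.add_0_r in *.
    (* The right move leaves the oracle head on the first 1 of the copied block, or on a blank when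
       [n = 0]; the query is therefore for [X n]. *)
    assert (Hr : forall t, t = move_right (Tape [] 0 (repeat 1 n)) ->
                 read_number t = n).
    { intros t ->; unfold read_number, move_right; destruct n; cbn;
        [|rewrite ones_repeat]; reflexivity. }
    eapply reaches_trans.
    { exists 0; cbn [run]; unfold execute; cbn - [write_number read_number].
      rewrite Hr by reflexivity; rewrite write_number_tape; reflexivity. }
    eapply reaches_trans; [apply H|].
    eapply reaches_step; [reflexivity|]; exists 0.
    cbn; destruct (X n); cbn; rewrite ?Nat.sub_0_r; reflexivity.
  - destruct (X n); cbn; rewrite ?Nat.sub_0_r, ?ones_repeat; reflexivity.
Qed.

Lemma computes_oracle : exists e, forall X n, computes e X n (X n).
Proof.
  destruct (machine_surj query_machine) as [e He]; exists e; intros X n.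
  destruct (query_machine_reaches X n) as (l & a & r & o & [k Hk] & H).
  exists k; cbv zeta; rewrite He, Hk; split; [reflexivity|exact H].
Qed.

(** * Compactness of Cantor space *)

Definition binary (s : list nat) : Prop := List.Forall (fun b => b <= 1) s.

Lemma cons_code_seq a s : cons_code a (seq_code s) = seq_code (a :: s).
Proof. reflexivity. Qed.

Lemma initial_S f n : initial f (S n) = initial f n ++ [f n].
Proof. unfold initial; rewrite seq_S, map_app; reflexivity. Qed.

Lemma initial_length f n : length (initial f n) = n.
Proof. unfold initial; now rewrite length_map, length_seq. Qed.

Lemma initial_binary f n : (forall k, f k <= 1) -> binary (initial f n).
Proof.
  intros H; apply Forall_forall; unfold initial; intros b [k [<- _]]%in_map_iff.
  apply H.
Qed.

Lemma initial_agree f g n k : initial f n = initial g n -> k < n -> f k = g k.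
Proof.
  intros H Hk.
  assert (E : forall h, nth k (initial h n) 0 = h k).
  { intros h; unfold initial.
    rewrite nth_indep with (d' := h 0) by (now rewrite length_map, length_seq).
    now rewrite map_nth, seq_nth. }
  now rewrite <- E, H, E.
Qed.

Lemma initial_add f n k : exists tau, initial f (n + k) = initial f n ++ tau.
Proof.
  exists (map f (List.seq n k)); unfold initial; now rewrite seq_app, map_app.
Qed.

Lemma prefix_code_initial g n : prefix_code g n = seq_code (initial g n).
Proof.
  enough (E : forall s,
    nat_rect (fun _ => nat -> nat) (fun c => c)
      (fun k E c => E (cons_code (g k) c)) n (seq_code s)
    = seq_code (initial g n ++ s)).
  { unfold prefix_code; change 0 with (seq_code []).
    now rewrite E, app_nil_r. }
  induction n as [|n IH]; intros s; [reflexivity|].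
  cbn [nat_rect]; rewrite cons_code_seq, IH, initial_S, <- app_assoc.
  reflexivity.
Qed.

Lemma seq_code_inj s s' : seq_code s = seq_code s' -> s = s'.
Proof. intros H; now rewrite <- (seq_codeK s), H, seq_codeK. Qed.

Lemma bad_sum_eq0 gamma e j s :
  bad_sum gamma e j (seq_code s) = 0 <->
  (forall tau, binary tau -> length tau = j ->
     1 <= gamma (seq_code (tau ++ s)) <= S e).
Proof.
  revert s; induction j as [|j IH]; intros s.
  - change (bad_sum gamma e 0 (seq_code s)) with (bad_leaf gamma e (seq_code s)).
    unfold bad_leaf; split.
    + intros H tau _ Ht; apply length_zero_iff_nil in Ht; subst; cbn [app]; lia.
    + intros H; specialize (H [] (List.Forall_nil _) eq_refl); cbn [app] in H; lia.
  - change (bad_sum gamma e (S j) (seq_code s)) with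
      (bad_sum gamma e j (seq_code (0 :: s)) + bad_sum gamma e j (seq_code (1 :: s))).
    split.
    + intros H tau Hb Hl.
      (* The recursion extends [s] at its front, so the digit to split off is the last one of
         [tau]. *)
      destruct (exists_last (l := tau)) as (tau' & b & ->).
      { intros ->; discriminate. }
      apply Forall_app in Hb as [Hb Hb1]; inversion Hb1 as [|? ? Hb2]; subst.
      rewrite length_app in Hl; cbn in Hl; rewrite <- app_assoc; cbn [app].
      assert (b = 0 \/ b = 1) as [-> | ->] by lia;
        [apply (proj1 (IH (0 :: s))) | apply (proj1 (IH (1 :: s)))];
        try assumption; lia.
    + intros H; apply Nat.eq_add_0; split; apply IH; intros tau Hb Hl;
        [specialize (H (tau ++ [0])) | specialize (H (tau ++ [1]))];
        rewrite <- app_assoc in H; apply H;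
        try (rewrite length_app; cbn; lia);
        apply Forall_app; (split; [assumption|repeat constructor]).
Qed.

Definition bounded_above (gamma : nat -> nat) (s : list nat) : Prop :=
  exists B, forall tau, binary tau -> B <= length tau ->
    1 <= gamma (seq_code (s ++ tau)) <= S B.

Lemma bounded_above_children gamma s :
  bounded_above gamma (s ++ [0]) -> bounded_above gamma (s ++ [1]) ->
  bounded_above gamma s.
Proof.
  (* The sum dominates both bounds; the successor excludes the empty extension and pays for the
     digit that selects the child. *)
  intros [B0 H0] [B1 H1]; exists (S (B0 + B1)).
  intros [|b tau] Hb Hl; cbn in Hl; [lia|].
  inversion Hb as [|? ? Hb1 Hb2]; subst.
  replace (s ++ b :: tau) with ((s ++ [b]) ++ tau) by (now rewrite <- app_assoc).
  assert (b = 0 \/ b = 1) as [-> | ->] by lia;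
    [specialize (H0 tau Hb2) | specialize (H1 tau Hb2)]; lia.
Qed.

(* If [gamma] were unbounded on the full binary tree, then by Koenig's lemma it would
   be unbounded above every node of some branch. *)
Lemma kleene_associate_bounded gamma :
  kleene_associate gamma -> bounded_above gamma [].
Proof.
  intros [Htot Hmon]; apply Classical_Prop.NNPP; intros Hnb.
  (* The branch turns to child 1 only if child 0 is bounded; by [bounded_above_children] child 1 is
     then unbounded. *)
  pose (next s := if excluded_middle_informative (bounded_above gamma (s ++ [0]))
                  then 1 else 0).
  pose (path := fix path n := match n with
                | 0 => [] | S m => path m ++ [next (path m)] end).
  assert (Hpath : forall n, path n = initial (fun k => next (path k)) n).
  { induction n as [|n IH]; [reflexivity|].
    rewrite initial_S, <- IH; reflexivity. }
  assert (Hun : forall n, ~ bounded_above gamma (path n)).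
  { induction n as [|n IH]; [exact Hnb|].
    change (path (S n)) with (path n ++ [next (path n)]).
    unfold next; destruct excluded_middle_informative; [|assumption].
    intros ?; now apply IH, bounded_above_children. }
  (* Some node of the branch has a positive value, which persists above it and so is a bound
     there. *)
  destruct (Htot (fun k => next (path k))) as [n Hn].
  apply (Hun n); rewrite Hpath.
  exists (gamma (seq_code (initial (fun k => next (path k)) n))).
  intros tau _ _; rewrite Hmon by assumption; lia.
Qed.

(** * Stabilization of the depth *)

Definition good_depth (gamma : nat -> nat) (e : nat) : Prop :=
  forall tau, binary tau -> length tau = e -> 1 <= gamma (seq_code tau) <= S e.

Lemma depth_S gamma k :
  depth gamma (S k) = depth gamma k /\ good_depth gamma (depth gamma k)
  \/ depth gamma (S k) = S (depth gamma k) /\ ~ good_depth gamma (depth gamma k).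
Proof.
  change (depth gamma (S k)) with
    (nat_rect (fun _ => nat) (depth gamma k) (fun _ _ => S (depth gamma k))
       (bad_sum gamma (depth gamma k) (depth gamma k) 0)).
  set (e := depth gamma k).
  assert (E : bad_sum gamma e e 0 = 0 <-> good_depth gamma e).
  { change 0 with (seq_code []) at 1; rewrite bad_sum_eq0; unfold good_depth.
    split; intros H tau; specialize (H tau); now rewrite app_nil_r in *. }
  destruct (bad_sum gamma e e 0); cbn; [left|right]; split; try reflexivity.
  - now apply E.
  - intros H; apply E in H; discriminate.
Qed.

Lemma depth_good gamma k i :
  good_depth gamma (depth gamma k) -> depth gamma (k + i) = depth gamma k.
Proof.
  intros H; induction i as [|i IH]; [now rewrite Nat.add_0_r|].
  rewrite Nat.add_succ_r, <- IH in *.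
  destruct (depth_S gamma (k + i)) as [[E _]|[_ N]]; tauto.
Qed.

(** Every failed test increments the depth, so it equals the stage until the search succeeds. *)
Lemma depth_dichotomy gamma k :
  good_depth gamma (depth gamma k) \/ depth gamma k = k.
Proof.
  induction k as [|k IH]; [now right|].
  destruct (depth_S gamma k) as [[-> H]|[-> N]]; [now left|].
  destruct IH as [H | ->]; [contradiction|now right].
Qed.

Lemma depth_incr gamma k i : depth gamma k <= depth gamma (k + i).
Proof.
  induction i as [|i IH]; [now rewrite Nat.add_0_r|].
  rewrite Nat.add_succ_r; destruct (depth_S gamma (k + i)); lia.
Qed.

(** At stage [B], the bound from compactness, the search has either succeeded or reached depth [B],
    which is good. *)
Lemma depth_stabilizes gamma :
  kleene_associate gamma -> exists k, good_depth gamma (depth gamma k).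
Proof.
  intros [B HB]%kleene_associate_bounded; exists B.
  destruct (depth_dichotomy gamma B) as [H|E]; [assumption|].
  rewrite E; intros tau Hb Hl; apply (HB tau Hb); lia.
Qed.

(** Positivity at length [e] forces the least positive length to be at most [e], and the value
    persists from there. Associates store values shifted by one, whence [S e] in [good_depth]. *)
Lemma good_depth_value gamma e f v :
  kleene_associate gamma -> good_depth gamma e -> (forall k, f k <= 1) ->
  associate_value gamma f v -> v <= e.
Proof.
  intros [_ Hmon] Hg Hf (n & Hpos & Hmin & ->).
  destruct (Hg (initial f e)) as [H1 H2];
    [now apply initial_binary|apply initial_length|].
  assert (Hne : n <= e).
  { destruct (le_lt_dec n e) as [|L]; [assumption|].
    rewrite (Hmin e L) in H1; lia. }
  destruct (initial_add f n (e - n)) as [tau Ht].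
  replace (n + (e - n)) with e in Ht by lia.
  rewrite Ht, Hmon in H2 by assumption; lia.
Qed.

(** * Binary representatives of reals in the unit interval *)

Open Scope R_scope.

Lemma rat_of_code_rat_code a b c :
  rat_of_code (rat_code a b c) = (INR a - INR b) / INR (S c).
Proof.
  unfold rat_of_code, rat_code, pair_code; now rewrite !Cantor.cancel_of_to.
Qed.

Lemma rat_code_surj q : exists a b c, rat_code a b c = q.
Proof.
  destruct (Cantor.of_nat q) as [p c] eqn:E, (Cantor.of_nat p) as [a b] eqn:E'.
  exists a, b, c; unfold rat_code, pair_code.
  now rewrite <- E', Cantor.cancel_to_of, <- E, Cantor.cancel_to_of.
Qed.

Lemma pow2_pred_eq k : INR (S (pow2_pred k)) = 2 ^ k.
Proof.
  induction k as [|k IH]; [reflexivity|].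
  change (pow2_pred (S k)) with (S (pow2_pred k + pow2_pred k)).
  rewrite !S_INR, plus_INR in *; cbn [pow]; lra.
Qed.

Definition binary_approx (g : nat -> nat) (k : nat) : R := INR (numer g k) / 2 ^ k.

Lemma binary_real_eq g k : rat_of_code (binary_real g k) = binary_approx g k.
Proof.
  unfold binary_real, binary_approx; rewrite rat_of_code_rat_code, pow2_pred_eq.
  cbn [INR]; now rewrite Rminus_0_r.
Qed.

Lemma inv_pow2_pos k : 0 < / 2 ^ k.
Proof. apply Rinv_0_lt_compat, pow_lt; lra. Qed.

Lemma inv_pow2_S k : / 2 ^ k = 2 * / 2 ^ S k.
Proof. cbn [pow]; field; apply pow_nonzero; lra. Qed.

Lemma inv_pow2_le j k : (j <= k)%nat -> / 2 ^ k <= / 2 ^ j.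
Proof.
  intros H; apply Rinv_le_contravar; [apply pow_lt; lra|].
  apply Rle_pow; [lra|assumption].
Qed.

Lemma inv_pow2_small eps : 0 < eps -> exists n, / 2 ^ n < eps.
Proof.
  intros He; destruct (pow_lt_1_zero (/ 2)) with (y := eps) as [N HN]; try assumption.
  { rewrite Rabs_right; lra. }
  exists N; specialize (HN N (le_n N)); rewrite pow_inv in HN.
  now rewrite Rabs_right in HN by (apply Rle_ge, Rlt_le, inv_pow2_pos).
Qed.

Lemma bit_le1 n : (bit n <= 1)%nat.
Proof. destruct n; cbn; lia. Qed.

Lemma binary_approx_0 g : binary_approx g 0 = 0.
Proof. unfold binary_approx; cbn; lra. Qed.

Lemma binary_approx_S g k :
  binary_approx g (S k) = binary_approx g k + INR (bit (g k)) * / 2 ^ S k.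
Proof.
  unfold binary_approx, Rdiv.
  change (numer g (S k)) with (numer g k + numer g k + bit (g k))%nat.
  rewrite !plus_INR, (inv_pow2_S k); ring.
Qed.

(** Each further digit selects the left or the right half of the current dyadic interval. *)
Lemma binary_approx_nested g k i :
  binary_approx g k <= binary_approx g (k + i)
  /\ binary_approx g (k + i) + / 2 ^ (k + i) <= binary_approx g k + / 2 ^ k.
Proof.
  induction i as [|i IH]; [rewrite Nat.add_0_r; lra|].
  rewrite Nat.add_succ_r, binary_approx_S; rewrite (inv_pow2_S (k + i)) in IH.
  pose proof (pos_INR (bit (g (k + i)%nat))).
  pose proof (le_INR _ _ (bit_le1 (g (k + i)%nat))) as Hb; cbn [INR] in Hb.
  pose proof (inv_pow2_pos (S (k + i))); nra.
Qed.

Lemma binary_approx_agree f g n :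
  (forall k, (k < n)%nat -> f k = g k) -> binary_approx f n = binary_approx g n.
Proof.
  induction n as [|n IH]; intros H; [reflexivity|].
  rewrite !binary_approx_S, IH, H by (intros; try apply H; lia); reflexivity.
Qed.

(** The intervals are closed, so dyadic rationals may have two expansions and 1 has the expansion
    with all digits 1. *)
Definition binary_expansion (g : nat -> nat) (x : R) : Prop :=
  forall k, binary_approx g k <= x <= binary_approx g k + / 2 ^ k.

Lemma binary_expansion_unit g x : binary_expansion g x -> 0 <= x <= 1.
Proof.
  intros H; specialize (H 0%nat); rewrite binary_approx_0 in H; cbn in H; lra.
Qed.

Lemma binary_expansion_represents g x :
  binary_expansion g x -> represents (binary_real g) x.
Proof.
  intros H; split.
  - intros k i; rewrite !binary_real_eq.
    pose proof (binary_approx_nested g k i); pose proof (inv_pow2_pos (k + i)).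
    rewrite Rabs_minus_sym, Rabs_right; lra.
  - apply is_lim_seq_ext with (binary_approx g).
    { intros k; now rewrite binary_real_eq. }
    apply is_lim_seq_spec; intros eps; destruct (inv_pow2_small eps) as [N HN];
      [apply cond_pos|].
    exists N; intros n Hn; specialize (H n); pose proof (inv_pow2_le N n Hn).
    rewrite Rabs_minus_sym, Rabs_right; lra.
Qed.

Lemma binary_expansion_exists g : exists x, binary_expansion g x.
Proof.
  assert (Hb : forall k, binary_approx g k <= 1).
  { intros k; pose proof (binary_approx_nested g 0 k) as H.
    pose proof (inv_pow2_pos k); rewrite binary_approx_0 in H.
    cbn [Nat.add pow] in H; lra. }
  destruct (ex_finite_lim_seq_incr (binary_approx g) 1) as [x Hx]; [|exact Hb|].
  { intros k; pose proof (binary_approx_nested g k 1) as H.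
    rewrite Nat.add_1_r in H; lra. }
  exists x; intros k; apply (is_lim_seq_incr_n _ k) in Hx.
  split.
  - apply (is_lim_seq_le (fun _ => binary_approx g k) _ (binary_approx g k) x)
      with (2 := is_lim_seq_const _) (3 := Hx).
    intros i; rewrite Nat.add_comm; apply binary_approx_nested.
  - apply (is_lim_seq_le _ (fun _ => binary_approx g k + / 2 ^ k)
             x (binary_approx g k + / 2 ^ k))
      with (2 := Hx) (3 := is_lim_seq_const _).
    intros i; rewrite Nat.add_comm; pose proof (binary_approx_nested g k i).
    pose proof (inv_pow2_pos (k + i)); lra.
Qed.

Lemma binary_expansion_surj y :
  0 <= y <= 1 -> exists g, (forall k, (g k <= 1)%nat) /\ binary_expansion g y.
Proof.
  intros Hy.
  (* Greedy digits: 1 is chosen whenever the new left endpoint does not exceed [y]. *)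
  pose (digit k (a : R) := if Rle_dec (a + / 2 ^ S k) y then 1%nat else 0%nat).
  pose (a := fix a k := match k with
             | O => 0 | S j => a j + INR (digit j (a j)) * / 2 ^ S j end).
  pose (g k := digit k (a k)).
  assert (Hg : forall k, bit (g k) = g k).
  { intros k; unfold g, digit; destruct Rle_dec; reflexivity. }
  assert (Ha : forall k, binary_approx g k = a k).
  { induction k as [|k IH]; [apply binary_approx_0|].
    rewrite binary_approx_S, IH, Hg; reflexivity. }
  exists g; split; [intros k; rewrite <- Hg; apply bit_le1|].
  intros k; rewrite Ha; induction k as [|k IH]; [cbn; lra|].
  change (a (S k)) with (a k + INR (digit k (a k)) * / 2 ^ S k).
  rewrite (inv_pow2_S k) in IH.
  unfold digit; destruct Rle_dec; cbn [INR]; lra.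
Qed.

(** Passage to the limit in the Cauchy estimate. *)
Lemma represents_error f x k : represents f x -> Rabs (rat_of_code (f k) - x) <= / 2 ^ k.
Proof.
  intros [Hc Hl].
  apply (is_lim_seq_le (fun i => Rabs (rat_of_code (f k) - rat_of_code (f (i + k)%nat)))
           (fun _ => / 2 ^ k) (Rabs (rat_of_code (f k) - x)) (/ 2 ^ k)).
  - intros i; rewrite Nat.add_comm; apply Hc.
  - apply (is_lim_seq_abs _ (Finite (rat_of_code (f k) - x))).
    apply is_lim_seq_minus'; [apply is_lim_seq_const|].
    now apply (is_lim_seq_incr_n (fun i => rat_of_code (f i))).
  - apply is_lim_seq_const.
Qed.

(** * The answer as a fast Cauchy sequence *)

Lemma radius_eq gamma k : rat_of_code (radius gamma k) = / 2 ^ depth gamma k.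
Proof.
  unfold radius; rewrite rat_of_code_rat_code, pow2_pred_eq; cbn [INR].
  unfold Rdiv; ring.
Qed.

(** While the search runs, the depth is the index itself, which gives the rate [2^-j]; afterwards
    the sequence is constant. *)
Lemma radius_represents gamma k :
  good_depth gamma (depth gamma k) ->
  represents (radius gamma) (/ 2 ^ depth gamma k).
Proof.
  intros Hk; split.
  - intros j i; rewrite !radius_eq.
    destruct (depth_dichotomy gamma j) as [H|E].
    + rewrite (depth_good _ _ i H), Rminus_diag, Rabs_R0.
      apply Rlt_le, inv_pow2_pos.
    + pose proof (inv_pow2_le _ _ (depth_incr gamma j i)).
      pose proof (inv_pow2_pos (depth gamma (j + i))).
      rewrite E in *; rewrite Rabs_right; lra.
  - apply (is_lim_seq_incr_n _ k).
    apply is_lim_seq_ext with (fun _ => / 2 ^ depth gamma k);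
      [|apply is_lim_seq_const].
    intros i; now rewrite radius_eq, Nat.add_comm, depth_good.
Qed.

(** * The reduction *)

Lemma cover_functional_scons Z sigma n a b c g :
  cover_functional Z (scons sigma (scons n (scons a (scons b (scons c g)))))
  = cover_test Z sigma n a b c g.
Proof. reflexivity. Qed.

Lemma cover_test_eq0 Z s n a b c g :
  cover_test Z (seq_code s) n a b c g = 0%nat <->
  initial g n = s
  /\ rat_code a b c = Z (scons n (binary_real g))
  /\ 3 * / 2 ^ n < (INR a - INR b) / INR (S c).
Proof.
  (* Multiplying by both denominators turns the strict inequality of reals into one of natural
     numbers. *)
  assert (E : (S (b * S (pow2_pred n) + 3 * S c) <= a * S (pow2_pred n))%nat <->
              3 * / 2 ^ n < (INR a - INR b) / INR (S c)).
  { assert (Hc : 0 < INR (S c)) by (apply lt_0_INR; lia).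
    assert (Hp : 0 < 2 ^ n) by (apply pow_lt; lra).
    assert (E3 : INR 3 = 3) by (cbn; lra).
    replace (3 * / 2 ^ n) with (3 * INR (S c) / (2 ^ n * INR (S c)))
      by (field; lra).
    replace ((INR a - INR b) / INR (S c))
      with ((INR a * 2 ^ n - INR b * 2 ^ n) / (2 ^ n * INR (S c)))
      by (field; lra).
    assert (Hd : 0 < / (2 ^ n * INR (S c)))
      by (apply Rinv_0_lt_compat, Rmult_lt_0_compat; lra).
    rewrite <- pow2_pred_eq, <- E3 in *; rewrite <- !mult_INR in *; unfold Rdiv.
    split; intros H.
    - apply Rmult_lt_compat_r; [assumption|].
      apply lt_INR in H; rewrite plus_INR in H; lra.
    - apply Rmult_lt_reg_r in H; [|assumption].
      apply INR_lt; rewrite plus_INR; lra. }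
  rewrite <- E; unfold cover_test, dist; rewrite prefix_code_initial; split.
  - intros H; repeat split; [apply seq_code_inj| |]; lia.
  - intros (-> & -> & H); lia.
Qed.

(** Only [n] and [g] are genuine witnesses: [a], [b], [c] must encode the value of [Z], and every
    number is such a code. *)
Lemma NFP_formula_cover Z s :
  NFP_formula (cover_functional Z) s <->
  exists n g, initial g n = s
    /\ 3 * / 2 ^ n < rat_of_code (Z (scons n (binary_real g))).
Proof.
  split.
  - intros [h Hh].
    apply (cover_test_eq0 Z s (h 0%nat) (h 1%nat) (h 2%nat) (h 3%nat)
             (fun k => h (4 + k)%nat)) in Hh as (Hs & Hq & H).
    exists (h 0%nat), (fun k => h (4 + k)%nat); split; [assumption|].
    now rewrite <- Hq, rat_of_code_rat_code.
  - intros (n & g & Hs & H).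
    destruct (rat_code_surj (Z (scons n (binary_real g)))) as (a & b & c & Hq).
    exists (scons n (scons a (scons b (scons c g)))).
    rewrite cover_functional_scons; apply cover_test_eq0.
    now rewrite <- Hq, rat_of_code_rat_code in H.
Qed.

Lemma NFP_premise_cover Z Psi :
  represents_pos_fun Z Psi ->
  forall f, exists n, NFP_formula (cover_functional Z) (initial f n).
Proof.
  intros HZ f; destruct (binary_expansion_exists f) as [x Hx].
  destruct (HZ x (binary_expansion_unit _ _ Hx)) as [Hpos Hrep].
  specialize (Hrep _ (binary_expansion_represents _ _ Hx)).
  (* The approximation of [Psi x] errs by at most [2^-n], so [4 * 2^-n < Psi x] leaves more than the
     required [3 * 2^-n]. *)
  destruct (inv_pow2_small (Psi x / 4)) as [n Hn]; [lra|].
  exists n; apply NFP_formula_cover; exists n, f; split; [reflexivity|].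
  pose proof (represents_error _ _ n Hrep) as He.
  apply Rabs_le_between in He; cbv beta in He; lra.
Qed.

(** Agreement of [g] and [f] up to [n] puts [x] and [y] in one interval of length [2^-n], so [z] is
    within [2 * 2^-n] of [x]. An approximation above [3 * 2^-n] with error at most [2^-n] makes
    [Psi x] larger than that. *)
Lemma NFP_formula_covers Z Psi f n y :
  represents_pos_fun Z Psi -> binary_expansion f y ->
  NFP_formula (cover_functional Z) (initial f n) ->
  exists x, 0 <= x <= 1 /\ forall z, Rabs (z - y) < / 2 ^ n -> Rabs (z - x) < Psi x.
Proof.
  intros HZ Hy (m & g & Hg & H)%NFP_formula_cover.
  assert (m = n) as -> by (now rewrite <- (initial_length g m), Hg, initial_length).
  destruct (binary_expansion_exists g) as [x Hx]; exists x.
  destruct (HZ x (binary_expansion_unit _ _ Hx)) as [_ Hrep].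
  specialize (Hrep _ (binary_expansion_represents _ _ Hx)).
  split; [exact (binary_expansion_unit _ _ Hx)|].
  intros z Hz; apply Rabs_lt_between in Hz.
  pose proof (represents_error _ _ n Hrep) as He; apply Rabs_le_between in He.
  cbv beta in He; specialize (Hx n); specialize (Hy n).
  rewrite (binary_approx_agree g f n) in Hx
    by (intros k Hk; now apply (initial_agree g f n)).
  apply Rabs_lt_between; lra.
Qed.

Lemma diameter_lt Y d y z :
  Rbar_lt (diameter Y) (Finite d) -> Y y -> Y z -> Rabs (z - y) < d.
Proof.
  intros H Hy Hz; unfold diameter in H.
  destruct (Lub_Rbar_correct
    (fun d => exists x y : R, Y x /\ Y y /\ d = Rabs (x - y))) as [Hub _].
  specialize (Hub (Rabs (z - y)) (ex_intro _ z (ex_intro _ y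
    (conj Hz (conj Hy eq_refl))))).
  exact (Rbar_le_lt_trans (Finite _) _ (Finite _) Hub H).
Qed.

Theorem theorem3 : strongly_N_reduces lebesgue_number_lemma NFP.
Proof.
  destruct computes_oracle as [e He].
  exists e, cover_term, radius_term.
  rewrite cover_term_sem, radius_term_sem.
  (* The machine must converge before any [Psi] is given; it does so for every [gamma], as
     [radius gamma] is total. *)
  intros Z gamma HN; exists (radius gamma); split; [intros n; apply He|].
  intros Psi HZ.
  destruct (HN (NFP_premise_cover Z Psi HZ)) as [Hk Hval].
  destruct (depth_stabilizes gamma Hk) as [k Hgood].
  exists (/ 2 ^ depth gamma k); split; [now apply radius_represents|].
  split; [apply inv_pow2_pos|]; intros Y HY Hd.
  destruct (excluded_middle_informative (exists y, Y y)) as [[y Hy]|Hempty].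
  - destruct (binary_expansion_surj y (HY y Hy)) as (f & Hf & Hexp).
    destruct (Hval f) as (v & Hv & HA).
    pose proof (good_depth_value _ _ _ _ Hk Hgood Hf Hv) as Hle.
    destruct (NFP_formula_covers Z Psi f v y HZ Hexp HA) as (x & Hx & Hball).
    exists x; split; [assumption|]; intros z Hz; apply Hball.
    (* Since [v] is at most the depth, a set of diameter below [2^-depth] lies within [2^-v] of its
       point [y]. *)
    apply Rlt_le_trans with (1 := diameter_lt _ _ _ _ Hd Hy Hz).
    now apply inv_pow2_le.
  - exists 0; split; [lra|]; intros y Hy; exfalso; eauto.
Qed.
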